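(* Let $A=(Q,q_0,F,I,T,X)$ be a timed automaton and let $\phi$ be a predicate on locations (with $F=\{q\mid\phi(q)\}$). Let $C$ be a finite set of triples $(q,Z,i)$ where $q\in Q$, $Z$ is a zone over $X$ (represented by a DBM in canonical form) and $i\in\mathbb{Z}$. Suppose that: (a) for every $(q,Z,i)\in C$, $Z\neq\emptyset$; (b) there exists $(q_0,Z_0,i)\in C$ with $\{\mathbf{0}\}\subseteq Z_0$; (c) for every $(q,Z,i)\in C$ and every $(q_1,Z_1)$ with $(q,Z)\Rightarrow(q_1,Z_1)$, there exists $(q_1,Z_1',j)\in C$ with $Z_1\subseteq Z_1'$, $i\ge j$, and ($\phi(q)$ implies $i>j$). Then the zone graph $\Rightarrow$ has no infinite path $(q_0,\{\mathbf{0}\}) = (p_0,W_0)\Rightarrow(p_1,W_1)\Rightarrow\cdots$ with $\phi(p_k)$ for infinitely many $k$. Consequently, the timed Büchi automaton $A$ is empty.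
   Context: A timed automaton $A=(Q,q_0,F,I,T,X)$ has a finite set of locations $Q$, initial location $q_0$, accepting locations $F\subseteq Q$, a finite set of clocks $X$, an invariant $I(q)$ for each location and a finite set $T$ of transitions $(q,g,R,q')$ with guard $g$ and reset set $R\subseteq X$; invariants and guards are conjunctions of constraints $x\,\#\,c$ with $x\in X$, $c\in\mathbb{N}$, $\#\in\{<,\le,=,\ge,>\}$. A clock valuation is a map $v:X\to\mathbb{R}_{\ge0}$; $\mathbf{0}$ is the all-zero valuation, assumed to satisfy $I(q_0)$. Steps: delay $(q,v)\to_\delta(q,v+\delta)$ for $\delta\ge0$ if $v+\delta$ satisfies $I(q)$; transition $(q,v)\to_t(q',v')$ for $t=(q,g,R,q')\in T$ if $v$ satisfies $g$, $v'$ equals $0$ on $R$ and $v$ elsewhere, and $v'$ satisfies $I(q')$. Write $(q,v)\to_{\delta,t}(q',v')$ if $(q,v)\to_\delta(q,v'')\to_t(q',v')$ for some $v''$. A run is an infinite sequence $(q_0,\mathbf{0})\to_{\delta_0,t_0}(q_1,v_1)\to_{\delta_1,t_1}\cdots$; it is non-Zeno if $\sum\delta_i$ is unbounded. The TBA $A$ is empty if it has no non-Zeno run visiting configurations with locations in $F$ infinitely often. A zone is a set of valuations defined by a conjunction of constraints $x\,\#\,c$ and $x-y\,\#\,c$ with $c\in\mathbb{Z}$. Zone graph: for nonempty sets of valuations $W,W'$, $(q,W)\Rightarrow^t(q',W')$ iff $W'$ is the set of all $v'$ such that $(q,v)\to_{\delta,t}(q',v')$ for some $v\in W$, $\delta\ge0$;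 $\Rightarrow=\bigcup_{t\in T}\Rightarrow^t$. *)

(* Defs.v *)
From HB Require Import structures.
From mathcomp Require Import all_boot all_order all_algebra.
From mathcomp Require Import all_classical reals interval_inference.

Set Implicit Arguments.
Unset Strict Implicit.
Unset Printing Implicit Defensive.

Import Order.TTheory GRing.Theory Num.Theory.

Local Open Scope classical_set_scope.
Local Open Scope ring_scope.

Inductive cmp := CLt | CLe | CEq | CGe | CGt.

Definition cmp_sem (R : realType) (o : cmp) (a b : R) : bool :=
  match o with
  | CLt => a < b
  | CLe => a <= b
  | CEq => a == b
  | CGe => a >= b
  | CGt => a > b
  end.

Definition valuation (X : finType) (R : realType) := X -> {nonneg R}.

Definition zero_val (X : finType) (R : realType) : valuation X R :=
  fun _ => 0%:nng.
Arguments zero_val : clear implicits.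

Definition delay_val (X : finType) (R : realType) (v : valuation X R)
    (d : {nonneg R}) : valuation X R :=
  fun x => ((v x)%:num + d%:num)%:nng.

Definition reset_val (X : finType) (R : realType) (v : valuation X R)
    (rs : {set X}) : valuation X R :=
  fun x => if x \in rs then 0%:nng else v x.

Record clock_constraint (X : finType) := ClockConstraint {
  cc_clock : X;
  cc_cmp : cmp;
  cc_const : nat
}.

Definition guard (X : finType) := seq (clock_constraint X).

Definition sat_guard (X : finType) (R : realType) (g : guard X)
    (v : valuation X R) : bool :=
  all (fun a => cmp_sem (cc_cmp a) (v (cc_clock a))%:num (cc_const a)%:R) g.

Record transition (Q X : finType) := Transition {
  tr_src : Q;
  tr_guard : guard X;
  tr_reset : {set X};
  tr_tgt : Q
}.

Record timed_automaton (Q X : finType) := TimedAutomaton {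
  ta_init : Q;
  ta_acc : {set Q};
  ta_inv : Q -> guard X;
  ta_trans : set (transition Q X);
  ta_trans_finite : finite_set ta_trans
}.

Definition config (Q X : finType) (R : realType) := (Q * valuation X R)%type.

Definition delay_step (Q X : finType) (R : realType)
    (A : timed_automaton Q X) (d : {nonneg R}) (s s' : config Q X R) : Prop :=
  [/\ s'.1 = s.1, s'.2 = delay_val s.2 d & sat_guard (ta_inv A s.1) s'.2].

Definition trans_step (Q X : finType) (R : realType)
    (A : timed_automaton Q X) (t : transition Q X)
    (s s' : config Q X R) : Prop :=
  [/\ ta_trans A t, tr_src t = s.1 & tr_tgt t = s'.1] /\
  [/\ sat_guard (tr_guard t) s.2, s'.2 = reset_val s.2 (tr_reset t)
    & sat_guard (ta_inv A s'.1) s'.2].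

Definition step (Q X : finType) (R : realType) (A : timed_automaton Q X)
    (d : {nonneg R}) (t : transition Q X) (s s' : config Q X R) : Prop :=
  exists v'' : valuation X R,
    delay_step A d s (s.1, v'') /\ trans_step A t (s.1, v'') s'.

Definition is_run (Q X : finType) (R : realType) (A : timed_automaton Q X)
    (s : nat -> config Q X R) (d : nat -> {nonneg R})
    (t : nat -> transition Q X) : Prop :=
  s 0%N = (ta_init A, zero_val X R) /\
  forall n, step A (d n) (t n) (s n) (s n.+1).

Definition non_zeno (R : realType) (d : nat -> {nonneg R}) : Prop :=
  forall B : R, exists n : nat, B < \sum_(i < n) (d i)%:num.

Definition infinitely_often (P : nat -> Prop) : Prop :=
  forall n : nat, exists2 m : nat, (n <= m)%N & P m.

Definition tba_empty (Q X : finType) (R : realType)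
    (A : timed_automaton Q X) : Prop :=
  ~ exists (s : nat -> config Q X R) (d : nat -> {nonneg R})
           (t : nat -> transition Q X),
      [/\ is_run A s d t, non_zeno d
        & infinitely_often (fun n => (s n).1 \in ta_acc A)].
Arguments tba_empty {Q X} R A.

Inductive zone_atom (X : finType) :=
  | ZClock of X & cmp & int
  | ZDiff of X & X & cmp & int.

Definition sat_zone_atom (X : finType) (R : realType) (v : valuation X R)
    (a : zone_atom X) : bool :=
  match a with
  | ZClock x o c => cmp_sem o (v x)%:num c%:~R
  | ZDiff x y o c => cmp_sem o ((v x)%:num - (v y)%:num) c%:~R
  end.

Definition is_zone (X : finType) (R : realType) (Z : set (valuation X R))
    : Prop :=
  exists cs : seq (zone_atom X), Z = [set v | all (sat_zone_atom v) cs].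

(* [Bound true c] stands for (<, c), [Bound false c] for (<=, c) and [Unbounded]
   for (<, oo). *)
Inductive bound := Unbounded | Bound of bool & int.

Definition sat_bound (R : realType) (a : R) (b : bound) : bool :=
  match b with
  | Unbounded => true
  | Bound strict c => if strict then a < c%:~R else a <= c%:~R
  end.

Definition le_bound (b b' : bound) : bool :=
  match b, b' with
  | _, Unbounded => true
  | Unbounded, Bound _ _ => false
  | Bound s c, Bound s' c' => (c < c') || (c == c') && (s' ==> s)
  end.

Definition add_bound (b b' : bound) : bound :=
  match b, b' with
  | Bound s c, Bound s' c' => Bound (s || s') (c + c')
  | _, _ => Unbounded
  end.

(* The index [None] is the reference clock, which is constantly 0; the entry
   [D x y] bounds x - y from above. *)
Definition dbm (X : finType) := option X -> option X -> bound.

Definition ext_val (X : finType) (R : realType) (v : valuation X R)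
    (x : option X) : R :=
  if x is Some y then (v y)%:num else 0.

Definition dbm_set (X : finType) (R : realType) (D : dbm X)
    : set (valuation X R) :=
  [set v | forall x y, sat_bound (ext_val v x - ext_val v y) (D x y)].
Arguments dbm_set {X} R D.

(* Tightness with respect to shortest paths, the constraints x - x <= 0 and
   0 - x <= 0 being part of the DBM. A diagonal entry (<, 0) is allowed, so the
   empty zone has canonical DBMs, for example the one with all entries
   (<, 0). *)
Definition canonical_dbm (X : finType) (D : dbm X) : Prop :=
  [/\ forall x, le_bound (D x x) (Bound false 0),
      forall x, le_bound (D None x) (Bound false 0)
    & forall x y z, le_bound (D x z) (add_bound (D x y) (D y z))].

Definition symb_state (Q X : finType) (R : realType) :=
  (Q * set (valuation X R))%type.

Definition zone_edge_by (Q X : finType) (R : realType)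
    (A : timed_automaton Q X) (t : transition Q X)
    (s s' : symb_state Q X R) : Prop :=
  [/\ s.2 !=set0, s'.2 !=set0
    & s'.2 = [set v' | exists (v : valuation X R) (d : {nonneg R}),
                         s.2 v /\ step A d t (s.1, v) (s'.1, v')]].

Definition zone_edge (Q X : finType) (R : realType)
    (A : timed_automaton Q X) (s s' : symb_state Q X R) : Prop :=
  exists2 t, ta_trans A t & zone_edge_by A t s s'.

(* Main.v *)
Require Import Defs.
From HB Require Import structures.
From mathcomp Require Import all_boot all_order all_algebra.
From mathcomp Require Import all_classical reals interval_inference.

Set Implicit Arguments.
Unset Strict Implicit.
Unset Printing Implicit Defensive.

Import Order.TTheory GRing.Theory Num.Theory.

Local Open Scope classical_set_scope.
Local Open Scope ring_scope.

(** Every path of the zone graph is simulated by the certificate: since the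
    successor operation is monotone in the zone, its k-th zone is contained in
    a zone of [C] whose index never increases and drops at each visit of [phi].
    The indices occurring in the finite set [C] are bounded below, so [phi] is
    visited finitely often. A run of the automaton lifts to the path of
    its successive symbolic images, all of which contain the run. *)

(** The successor set required by [zone_edge_by], freed of its nonemptiness conditions so that it is
    a total function of [W]. *)
Definition zone_post (Q X : finType) (R : realType) (A : timed_automaton Q X)
    (t : transition Q X) (q q' : Q) (W : set (valuation X R)) :
    set (valuation X R) :=
  [set v' | exists (v : valuation X R) (d : {nonneg R}),
              W v /\ step A d t (q, v) (q', v')].

Lemma zone_post_edge (Q X : finType) (R : realType) (A : timed_automaton Q X)
    (t : transition Q X) (q q' : Q) (W : set (valuation X R))
    (v v' : valuation X R) (d : {nonneg R}) :
  W v -> step A d t (q, v) (q', v') ->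
  zone_post A t q q' W v' /\ zone_edge A (q, W) (q', zone_post A t q q' W).
Proof.
move=> Wv st; have post_v' : zone_post A t q q' W v' by exists v, d.
split=> //; have [v'' [_ [[At _ _] _]]] := st.
by exists t => //; split=> //; [exists v | exists v'].
Qed.

(** An edge has a nonempty target, so some concrete step leaves [W]. The same step leaves [Z], which
    makes the successor of [Z] nonempty and hence an edge. *)
Lemma zone_edge_mono (Q X : finType) (R : realType) (A : timed_automaton Q X)
    (q q' : Q) (W W' Z : set (valuation X R)) :
  W `<=` Z -> zone_edge A (q, W) (q', W') ->
  exists2 Z', W' `<=` Z' & zone_edge A (q, Z) (q', Z').
Proof.
move=> WZ [t _ [/= _ [v' W'v'] eW']].
have [v [d [Wv st]]] : zone_post A t q q' W v' by rewrite /zone_post -eW'.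
exists (zone_post A t q q' Z); last by case: (zone_post_edge (WZ _ Wv) st).
by rewrite eW' => u' [u [e [Wu stu]]]; exists u, e; split=> //; exact: WZ.
Qed.

Lemma finite_set_int_lb (S : set int) :
  finite_set S -> exists m, forall i, S i -> m <= i.
Proof.
move=> /finite_seqP[s ->]; elim: s => [|a s [m le_m]]; first by exists 0.
exists (Num.min a m) => i /=; rewrite inE => /orP[/eqP->|/le_m le_mi].
  by rewrite ge_min lexx.
by rewrite ge_min le_mi orbT.
Qed.

Section Certificate.
Variables (R : realType) (Q X : finType) (A : timed_automaton Q X).
Variables (phi : pred Q) (C : set (Q * set (valuation X R) * int)).
Hypothesis C_step : forall q Z i, C (q, Z, i) ->
  forall q1 Z1, zone_edge A (q, Z) (q1, Z1) ->
  exists Z1' j, [/\ C (q1, Z1', j), Z1 `<=` Z1', j <= i & (phi q -> j < i)].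

Lemma certificate_simulation (p : nat -> symb_state Q X R) Z i :
  (forall k, zone_edge A (p k) (p k.+1)) ->
  C ((p 0%N).1, Z, i) -> (p 0%N).2 `<=` Z ->
  forall k, exists Z' j, [/\ C ((p k).1, Z', j), (p k).2 `<=` Z', j <= i
    & forall l, (l < k)%N -> phi (p l).1 -> j < i].
Proof.
move=> p_edge C0 p0Z; elim=> [|k [Zk [j [Ck pkZ le_ji lt_ji]]]].
  by exists Z, i.
move: (p_edge k); rewrite (surjective_pairing (p k)).
rewrite (surjective_pairing (p k.+1)) => /(zone_edge_mono pkZ)[Z1 sub1 edge1].
have [Z2 [j' [C2 sub2 le_j'j lt_j'j]]] := C_step Ck edge1.
exists Z2, j'; split=> //; first exact: subset_trans sub1 sub2.
  exact: le_trans le_j'j le_ji.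
(* For [l = k] the index drops at the new edge; for [l < k] it has dropped before and cannot rise
   again. *)
move=> l; rewrite ltnS leq_eqVlt => /predU1P[->|lt_lk] phi_l.
  exact: lt_le_trans (lt_j'j phi_l) le_ji.
exact: le_lt_trans le_j'j (lt_ji l lt_lk phi_l).
Qed.

(** The path may start at any symbolic state covered by [C], so that the induction can restart at a
    tail of the path. *)
Lemma certificate_no_path (p : nat -> symb_state Q X R) Z i :
  finite_set C -> (forall k, zone_edge A (p k) (p k.+1)) ->
  C ((p 0%N).1, Z, i) -> (p 0%N).2 `<=` Z ->
  ~ infinitely_often (fun k => phi (p k).1).
Proof.
move=> /(finite_image snd) /finite_set_int_lb[m C_ge].
have {}C_ge q Y j : C (q, Y, j) -> m <= j by move=> Cj; apply: C_ge; exists (q, Y, j).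
(* [n] bounds how far the index can still fall above [m]; each visit of [phi] costs at least one
   unit, and at [n = 0] the index would lie below [m]. *)
have [n lt_in] : exists n : nat, i < m + n%:Z.
  exists `|i - m|.+1; rewrite -ltrBlDl.
  by apply: le_lt_trans (ler_norm _) _; rewrite -abszE ltz_nat.
elim: n p Z i lt_in => [|n IHn] p Z i lt_in p_edge C0 p0Z io.
  by move: lt_in; rewrite addr0 ltNge (C_ge _ _ _ C0).
have [l _ phi_l] := io 0%N.
have [Z' [j [C' sub' _ lt_ji]]] := certificate_simulation p_edge C0 p0Z l.+1.
(* The tail just after the visit at [l] starts inside [Z'], whose index [j < i] satisfies the bound
   with [n] in place of [n.+1]. *)
apply: (IHn (fun k => p (l.+1 + k)%N) Z' j).
- have := lt_le_trans (lt_ji l (ltnSn l) phi_l) (_ : i <= m + n%:Z); apply.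
  by rewrite -ltzD1 -addrA -PoszD addn1.
- by move=> k; rewrite addnS.
- by rewrite addn0.
- by rewrite addn0.
(* A visit of [p] at [k'] is a visit of the tail at [k' - l.+1], so asking for [l.+1 + k <= k']
   gives one at or after [k]. *)
move=> k; have [k' le_kk' phi_k'] := io (l.+1 + k)%N.
exists (k' - l.+1)%N; first by rewrite leq_subRL // (leq_trans _ le_kk') ?leq_addr.
by rewrite subnKC // (leq_trans _ le_kk') ?leq_addr.
Qed.
End Certificate.

Lemma run_zone_path (R : realType) (Q X : finType) (A : timed_automaton Q X)
    (s : nat -> config Q X R) (d : nat -> {nonneg R})
    (t : nat -> transition Q X) :
  is_run A s d t -> exists p : nat -> symb_state Q X R,
    [/\ p 0%N = (ta_init A, [set zero_val X R]),
        forall k, zone_edge A (p k) (p k.+1)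
      & forall k, (p k).1 = (s k).1].
Proof.
move=> [s0 s_step].
(* [W] follows the locations and transitions of the run but leaves the delays free. The run staying
   in [W] is what provides nonemptiness for every edge. *)
pose W := fix W k := if k is k'.+1
  then zone_post A (t k') (s k').1 (s k).1 (W k') else [set zero_val X R].
have post_k k v : W k (s k).2 -> v = (s k.+1).2 ->
    W k.+1 v /\ zone_edge A ((s k).1, W k) ((s k.+1).1, W k.+1).
  move=> Wk ->; apply: (zone_post_edge (d := d k)) Wk _.
  by rewrite -!surjective_pairing; exact: s_step.
have W_s k : W k (s k).2.
  by elim: k => [|k Wk]; [rewrite s0 | case: (post_k k _ Wk erefl)].
exists (fun k => ((s k).1, W k)); split=> // [|k]; first by rewrite s0.
by case: (post_k k _ (W_s k) erefl).
Qed.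

Theorem theorem4 (R : realType) (Q X : finType) (A : timed_automaton Q X)
    (hinit : sat_guard (ta_inv A (ta_init A)) (zero_val X R))
    (phi : pred Q) (hF : ta_acc A = [set q | phi q]%SET)
    (C : set (Q * set (valuation X R) * int))
    (hCfin : finite_set C)
    (hCzone : forall q Z i, C (q, Z, i) ->
       is_zone Z /\ exists2 D : dbm X, canonical_dbm D & Z = dbm_set R D)
    (ha : forall q Z i, C (q, Z, i) -> Z <> set0)
    (hb : exists Z0 i, C (ta_init A, Z0, i) /\ [set zero_val X R] `<=` Z0)
    (hc : forall q Z i, C (q, Z, i) ->
       forall q1 Z1, zone_edge A (q, Z) (q1, Z1) ->
       exists Z1' j,
         [/\ C (q1, Z1', j), Z1 `<=` Z1', j <= i & (phi q -> j < i)]) :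
  (~ exists p : nat -> symb_state Q X R,
       [/\ p 0%N = (ta_init A, [set zero_val X R]),
           forall k, zone_edge A (p k) (p k.+1)
         & infinitely_often (fun k => phi (p k).1)]) /\
  tba_empty R A.
Proof.
have no_path : ~ exists p : nat -> symb_state Q X R,
    [/\ p 0%N = (ta_init A, [set zero_val X R]),
        forall k, zone_edge A (p k) (p k.+1)
      & infinitely_often (fun k => phi (p k).1)].
  move=> [p [p0 p_edge]]; have [Z0 [i [C0 sub0]]] := hb.
  by apply: (certificate_no_path hc (Z := Z0) (i := i)) => //; rewrite p0.
split=> // -[s [d [t [run_s _ io]]]].
have [p [p0 p_edge p_s]] := run_zone_path run_s.
apply: no_path; exists p; split=> // n; have [m le_nm] := io n.
by rewrite hF inE => phi_m; exists m; rewrite ?p_s.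
Qed.
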